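(* Let $X$ be a random variable having the RTGLE$(\alpha,\beta,\gamma,p)$ distribution. The quantile function $Q(u)$ of $X$ is given by $$Q(u)=\frac{-\alpha+\sqrt{\alpha^{2}+2\beta\, C_{p,u,\gamma}}}{\beta},\quad 0<u<1,$$ where $$C_{p,u,\gamma}=\left(-\frac{1}{p}\left[1+p\,W_{-1}\left(\frac{u-1}{p\,e^{1/p}}\right)\right]\right)^{1/\gamma}$$ and $W_{-1}(\cdot)$ denotes the negative branch of the Lambert $W$ function.
   Context: The record-based transmuted generalized linear exponential distribution RTGLE$(\alpha,\beta,\gamma,p)$, with parameters $\alpha\ge 0$, $\beta\ge 0$ ($\alpha$ and $\beta$ not both zero), $\gamma>0$, $p\in[0,1]$, is the distribution on $(0,\infty)$ with distribution function $$F(x)=1-\left[1+p\left(\alpha x+\frac{\beta x^{2}}{2}\right)^{\gamma}\right]e^{-\left(\alpha x+\frac{\beta x^{2}}{2}\right)^{\gamma}},\quad x>0.$$ The quantile function $Q$ is the inverse of $F$: for $u\in(0,1)$, $Q(u)$ is the solution $x>0$ of $F(x)=u$. The Lambert $W$ function is defined as the (multi-valued) solution of $W(v)e^{W(v)}=v$; for real $v\in[-1/e,0)$, the negative branch $W_{-1}(v)$ is the real solution $w$ of $we^{w}=v$ with $w\in(-\infty,-1]$.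
   Formalization: The formula is stated for β ≠ 0 and p ≠ 0 only; the parameter space also allows β = 0 or p = 0, but there the displayed expressions divide by zero and are undefined. *)

(* Defs.v *)
From HB Require Import structures.
From mathcomp Require Import all_boot all_order all_algebra.
From mathcomp Require Import all_classical all_reals all_analysis.

Set Implicit Arguments.
Unset Strict Implicit.
Unset Printing Implicit Defensive.

Import Order.TTheory GRing.Theory Num.Theory.
Import numFieldNormedType.Exports.

Local Open Scope classical_set_scope.
Local Open Scope ring_scope.

(* The negative real branch of the Lambert function.  It is meaningful only
   for v in [-1/e, 0), where the set below is a singleton; elsewhere [get]
   may return a junk value. *)
Definition lambertWm1 (R : realType) (v : R) : R :=
  get [set w : R | w <= -1 /\ w * expR w = v].

Definition rtgle_cdf (R : realType) (alpha beta gamma p x : R) : R :=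
  let t := (alpha * x + beta * x ^+ 2 / 2) `^ gamma in
  1 - (1 + p * t) * expR (- t).

(* The law is carried by (0, +oo), hence the value 0 on the other half-line. *)
Definition has_RTGLE (d : measure_display) (T : measurableType d)
    (R : realType) (P : probability T R) (X : {RV P >-> R})
    (alpha beta gamma p : R) : Prop :=
  forall x : R,
    cdf X x = (if 0 < x then rtgle_cdf alpha beta gamma p x else 0)%:E.

Definition quantile_eq (d : measure_display) (T : measurableType d)
    (R : realType) (P : probability T R) (X : {RV P >-> R}) (u x : R) : Prop :=
  0 < x /\ cdf X x = u%:E.

(* Quantile function of a positive random variable, as the inverse of its
   distribution function; meaningful when [quantile_eq X u] has exactly one
   solution. *)
Definition quantile (d : measure_display) (T : measurableType d)
    (R : realType) (P : probability T R) (X : {RV P >-> R}) (u : R) : R :=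
  get [set x : R | quantile_eq X u x].

Definition rtgle_C (R : realType) (p u gamma : R) : R :=
  (- (1 / p) * (1 + p * lambertWm1 ((u - 1) / (p * expR (1 / p)))))
    `^ (1 / gamma).

(* Main.v *)
Require Import Defs.
From HB Require Import structures.
From mathcomp Require Import all_boot all_order all_algebra.
From mathcomp Require Import all_classical all_reals all_analysis.
From mathcomp Require Import ring lra.

Set Implicit Arguments.
Unset Strict Implicit.
Unset Printing Implicit Defensive.

Import Order.TTheory GRing.Theory Num.Theory.
Import numFieldNormedType.Exports.

Local Open Scope ring_scope.

(** With [t = (alpha x + beta x^2 / 2)^gamma] and [w = - (t + 1 / p)], the
    equation [F(x) = u] reads [w e^w = (u - 1) / (p e^(1/p))].  Since [t >= 0]
    and [p <= 1], [w <= -1], where [w e^w] is injective; hence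
    [w] is the value of the negative Lambert branch, which determines [t], and
    [x] is then the positive root of a quadratic equation. *)

(** Writing d = b - a > 0, the inequality e^d > 1 + d and b < 0 give b e^d < b (1 + d) = b + b d.
    The bound b <= -1 makes this at most b - d = a, and multiplying by e^a concludes. *)
Lemma mul_expR_decreasing (R : realType) (a b : R) :
  a < b -> b <= -1 -> b * expR b < a * expR a.
Proof.
move=> ab b1.
have e1 : 1 + (b - a) < expR (b - a) by apply: expR_gt1Dx; lra.
have -> : expR b = expR (b - a) * expR a by rewrite -expRD subrK.
rewrite mulrA ltr_pM2r ?expR_gt0//.
by nra.
Qed.

Lemma mul_expR_inj (R : realType) (a b : R) :
  a <= -1 -> b <= -1 -> a * expR a = b * expR b -> a = b.
Proof.
move=> a1 b1 ab; case: (ltgtP a b) => // [lt|lt].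
- by have := mul_expR_decreasing lt b1; rewrite ab ltxx.
- by have := mul_expR_decreasing lt a1; rewrite ab ltxx.
Qed.

(** [w] itself witnesses that the defining set is nonempty, so [get] returns a member of it, and
    injectivity on (-oo, -1] leaves only [w]. *)
Lemma lambertWm1_mul_expR (R : realType) (w : R) :
  w <= -1 -> lambertWm1 (w * expR w) = w.
Proof.
move=> w1; have [] : [set z : R | z <= -1 /\ z * expR z = w * expR w]%classic
    (lambertWm1 (w * expR w)) by exact: (@getI _ _ w).
by move=> z1 zw; exact: mul_expR_inj zw.
Qed.

Lemma survival_lambert (R : realType) (p s : R) : p != 0 ->
  - (s + 1 / p) * expR (- (s + 1 / p)) =
  - ((1 + p * s) * expR (- s)) / (p * expR (1 / p)).
Proof.
move=> p0; rewrite opprD expRD [expR (- (1 / p))]expRN.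
by field; rewrite p0 gt_eqF ?expR_gt0.
Qed.

Lemma oppr_shift_le_N1 (R : realType) (p s : R) :
  0 < p <= 1 -> 0 <= s -> - (s + 1 / p) <= -1.
Proof.
move=> /andP[p0 p1] s0; rewrite lerN2.
by have : 1 <= 1 / p; [rewrite ler_pdivlMr // mul1r | lra].
Qed.

Lemma survival_inj (R : realType) (p s t : R) : 0 < p <= 1 ->
  0 <= s -> 0 <= t ->
  (1 + p * s) * expR (- s) = (1 + p * t) * expR (- t) -> s = t.
Proof.
move=> hp s0 t0 st; have p0 : p != 0 by rewrite gt_eqF //; case/andP: hp.
have : - (s + 1 / p) = - (t + 1 / p).
  by apply: mul_expR_inj; rewrite ?oppr_shift_le_N1 ?survival_lambert// st.
by lra.
Qed.

(** Intermediate value theorem on [0, m]: the survival expression is 1 at 0 and has dropped to at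
    most q at a suitable m. This supplies a solution for every level u. *)
Lemma survival_surj (R : realType) (p q : R) : p <= 1 -> 0 < q < 1 ->
  exists2 s : R, 0 < s & (1 + p * s) * expR (- s) = q.
Proof.
move=> p1 /andP[q0 q1].
pose f s : R := (1 + p * s) * expR (- s).
(* [1 + p m <= 2 (1 + m / 2) <= 2 e^(m/2)], so [f m <= 2 e^(-m/2) = q]. *)
pose m := - 2 * ln (q / 2).
have q20 : q / 2 \is Num.pos by rewrite posrE; lra.
have m0 : 0 < m by have : ln (q / 2) < 0; [apply: ln_lt0; lra | rewrite /m; lra].
have f0 : f 0 = 1 by rewrite /f mulr0 addr0 oppr0 expR0 mulr1.
have fm : f m <= q.
  have e1 := expR_ge1Dx (m / 2).
  have e2 : expR (- (m / 2)) = q / 2.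
    by rewrite -[RHS](lnK q20); congr expR; rewrite /m; field.
  have e3 : expR (m / 2) * (q / 2) = 1 by rewrite -e2 -expRD subrr expR0.
  have -> : f m = (1 + p * m) * ((q / 2) * (q / 2)).
    by rewrite /f -e2 -expRD; congr (_ * expR _); field.
  have le : 1 + p * m <= 2 * expR (m / 2) by nra.
  have : (1 + p * m) * ((q / 2) * (q / 2)) <=
         2 * expR (m / 2) * ((q / 2) * (q / 2)).
    by rewrite ler_wpM2r // mulr_ge0 //; lra.
  (* The upper bound equals q, because e^(m/2) (q/2) = 1 by [e3]. *)
  by rewrite [X in _ <= X -> _](_ : _ = expR (m / 2) * (q / 2) * q);
    [rewrite e3 mul1r | field].
have cf : {within `[0, m], continuous f}%classic.
  apply: continuous_subspaceT => x; rewrite /f.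
  apply: cvgM; last first.
    by apply: continuous_comp; [exact: continuousN | exact: continuous_expR].
  by apply: cvgD; [exact: cvg_cst | apply: cvgM; [exact: cvg_cst | exact: cvg_id]].
have [s /[!in_itv]/= /andP[s0 _] fs] : exists2 c, c \in `[0, m] & f c = q.
  apply: IVT => //; first exact: ltW.
  by rewrite f0 ge_min le_max fm (ltW q1) orbT.
(* The interval only gives 0 <= s; s = 0 is excluded since f 0 = 1 > q. *)
exists s => //; rewrite lt_neqAle s0 andbT; apply/eqP => s_0.
by move: fs; rewrite -s_0 f0; lra.
Qed.

(** Completing the square turns the radicand into (a + b x)^2, and a + b x >= 0 selects the root.
    Conversely r^2 = a^2 + 2 b c > a^2 gives r > a, hence x > 0. *)
Lemma pos_quadratic_root (R : realType) (a b c x : R) :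
  0 <= a -> 0 < b -> 0 < c ->
  (0 < x /\ a * x + b * x ^+ 2 / 2 = c) <->
  x = (- a + Num.sqrt (a ^+ 2 + 2 * b * c)) / b.
Proof.
move=> a0 b0 c0; have bN0 : b != 0 by rewrite gt_eqF.
split=> [[x0 <-]|->].
- have -> : a ^+ 2 + 2 * b * (a * x + b * x ^+ 2 / 2) = (a + b * x) ^+ 2.
    by field.
  rewrite sqrtr_sqr ger0_norm; first by field.
  by rewrite addr_ge0 // mulr_ge0 // ltW.
set r := Num.sqrt _.
have bc : 0 < b * c by rewrite mulr_gt0.
have r2 : r ^+ 2 = a ^+ 2 + 2 * b * c by rewrite sqr_sqrtr //; nra.
have r0 : 0 <= r by exact: sqrtr_ge0.
split; first by rewrite divr_gt0 //; nra.
have -> : a * ((- a + r) / b) + b * ((- a + r) / b) ^+ 2 / 2 =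
  (r ^+ 2 - a ^+ 2) / (2 * b) by field.
by rewrite r2; field.
Qed.

Lemma powR_eq_inv (R : realType) (y s g : R) : 0 <= y -> 0 < s -> 0 < g ->
  y `^ g = s <-> y = s `^ (1 / g).
Proof.
move=> y0 s0 g0; have gN0 : g != 0 by rewrite gt_eqF.
by split=> [<-|->]; rewrite -powRrM ?mul1r ?mulfV ?mulVf // powRr1 // ltW.
Qed.

Theorem theorem3 (d : measure_display) (T : measurableType d) (R : realType)
    (P : probability T R) (X : {RV P >-> R}) (alpha beta gamma p : R)
    (halpha : 0 <= alpha) (hbeta : 0 <= beta)
    (halphabeta : ~ (alpha = 0 /\ beta = 0))
    (hgamma : 0 < gamma) (hp : 0 <= p <= 1)
    (hbeta0 : beta <> 0) (hp0 : p <> 0)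
    (hX : has_RTGLE X alpha beta gamma p) :
  forall u : R, 0 < u < 1 ->
    (exists! x : R, quantile_eq X u x) /\
    quantile X u =
      (- alpha + Num.sqrt (alpha ^+ 2 + 2 * beta * rtgle_C p u gamma)) / beta.
Proof.
move=> u /andP[u0 u1].
have b0 : 0 < beta by rewrite lt_neqAle hbeta andbT eq_sym; apply/eqP.
have pN0 : p != 0 by apply/eqP.
have hp' : 0 < p <= 1.
  by case/andP: hp => p_ge0 ->; rewrite andbT lt_neqAle p_ge0 eq_sym pN0.
have [s s0 su] : exists2 s : R, 0 < s & (1 + p * s) * expR (- s) = 1 - u.
  by apply: survival_surj; [case/andP: hp' | lra].
(* The Lambert value is w = - (s + 1/p), and - (1/p) (1 + p w) = s. *)
have rtgle_CE : rtgle_C p u gamma = s `^ (1 / gamma).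
  rewrite /rtgle_C.
  have -> : (u - 1) / (p * expR (1 / p)) =
      - (s + 1 / p) * expR (- (s + 1 / p)).
    by rewrite survival_lambert // su opprB.
  rewrite lambertWm1_mul_expR ?(oppr_shift_le_N1 hp' (ltW s0))//.
  by congr (_ `^ _); field.
have C0 : 0 < rtgle_C p u gamma by rewrite rtgle_CE powR_gt0.
(* This equivalence yields existence, uniqueness and the value chosen by [get] all at once. *)
have quantileP x : quantile_eq X u x <->
    x = (- alpha + Num.sqrt (alpha ^+ 2 + 2 * beta * rtgle_C p u gamma)) / beta.
  apply: iff_trans (pos_quadratic_root x halpha b0 C0).
  rewrite /quantile_eq hX; split=> -[x0]; rewrite x0; last first.
    have y0 : 0 <= alpha * x + beta * x ^+ 2 / 2 by nra.
    rewrite rtgle_CE => /(powR_eq_inv y0 s0 hgamma) ts.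
    by split=> //; congr (_%:E); rewrite /rtgle_cdf ts su; lra.
  have y0 : 0 <= alpha * x + beta * x ^+ 2 / 2 by nra.
  move=> [Fu]; split=> //; rewrite rtgle_CE; apply/(powR_eq_inv y0 s0 hgamma).
  apply: (survival_inj hp' (powR_ge0 _ _) (ltW s0)); rewrite su.
  by move: Fu; rewrite /rtgle_cdf; lra.
split.
  by eexists; split=> [|x /quantileP ->]; first exact/quantileP.
by apply/quantileP/(@getPex _ (quantile_eq X u)); eexists; exact/quantileP.
Qed.
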